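(* Let $C$ be a real symmetric positive-semidefinite matrix of order $n$ and let $0<s<n$ be an integer. If $s>\operatorname{rank}(C)$, then $$\lim_{\gamma\to+\infty}\operatorname{linx}(C,s;\gamma)=-\infty,$$ and there is no optimal $\gamma$, i.e., there is no $\hat\gamma>0$ with $\operatorname{linx}(C,s;\hat\gamma)=\inf_{\gamma>0}\operatorname{linx}(C,s;\gamma)$.
   Context: Notation: $\mathbf{e}$ is the all-ones vector in $\mathbb{R}^n$; $\operatorname{Diag}(x)$ is the diagonal matrix with diagonal $x$; $\operatorname{ldet}$ is the natural logarithm of the determinant (with value $-\infty$ if the determinant is $0$). For integers $0<s<n$, $P(n,s):=\{x\in\mathbb{R}^n:\mathbf{e}^\top x=s,\ 0\le x\le\mathbf{e}\}$. For a real symmetric positive-semidefinite matrix $C$ of order $n$ and $\gamma>0$, the scaled linx bound is $$\operatorname{linx}(C,s;\gamma):=\max\left\{\tfrac12\Big(\operatorname{ldet}\big(\gamma C\operatorname{Diag}(x)C+\operatorname{Diag}(\mathbf{e}-x)\big)-s\log\gamma\Big): x\in P(n,s)\right\}.$$ *)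

(* Defs.v *)
From mathcomp Require Import all_boot all_order all_fingroup all_algebra.
From mathcomp Require Import all_classical all_reals all_analysis.

Set Implicit Arguments.
Unset Strict Implicit.
Unset Printing Implicit Defensive.

Import Order.TTheory GRing.Theory Num.Theory.
Import numFieldNormedType.Exports.

Local Open Scope classical_set_scope.
Local Open Scope ring_scope.

Definition psdmx (R : realType) (n : nat) (C : 'M[R]_n) : Prop :=
  C^T = C /\ forall v : 'rV[R]_n, 0 <= (v *m C *m v^T) 0 0.

Definition Pns (R : realType) (n s : nat) : set 'rV[R]_n :=
  [set x | \sum_(i < n) x 0 i = s%:R /\ forall i, 0 <= x 0 i <= 1].
Arguments Pns : clear implicits.

(* [lne] sends 0 to -oo, as required. Its junk value -oo on negative numbers is
   never used: for C PSD, gamma > 0 and x in [Pns], [linx_mx] below is PSD. *)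
Definition ldet (R : realType) (n : nat) (M : 'M[R]_n) : \bar R :=
  lne (\det M)%:E.

Definition linx_mx (R : realType) (n : nat) (C : 'M[R]_n) (gamma : R)
    (x : 'rV[R]_n) : 'M[R]_n :=
  gamma *: (C *m diag_mx x *m C) + diag_mx (const_mx 1 - x).

Definition linx_obj (R : realType) (n : nat) (C : 'M[R]_n) (s : nat)
    (gamma : R) (x : 'rV[R]_n) : \bar R :=
  ((2^-1)%:E * (ldet (linx_mx C gamma x) - (s%:R * ln gamma)%:E))%E.

(* The supremum is a maximum: see [linx_max] below. *)
Definition linx (R : realType) (n : nat) (C : 'M[R]_n) (s : nat) (gamma : R) :
    \bar R :=
  ereal_sup [set linx_obj C s gamma x | x in Pns R n s].

Lemma le_lne (R : realType) (x y : R) :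
  x <= y -> (lne x%:E <= lne y%:E)%E.
Proof.
move=> xy; have [x0|x0] := leP x 0; first by rewrite [lne x%:E]le0_lneNy ?leNye.
have y0 := lt_le_trans x0 xy.
by rewrite !lne_EFin // lee_fin ler_ln.
Qed.

Lemma cvg_bsum (R : realType) (T : topologicalType) (I : finType)
    (F : I -> T -> R) (x : T) : (forall i, F i y @[y --> x] --> F i x) ->
  \sum_i F i y @[y --> x] --> \sum_i F i x.
Proof. by move=> cF; apply: cvg_big => //; exact: add_continuous. Qed.

Lemma cvg_bprod (R : realType) (T : topologicalType) (I : finType)
    (F : I -> T -> R) (x : T) : (forall i, F i y @[y --> x] --> F i x) ->
  \prod_i F i y @[y --> x] --> \prod_i F i x.
Proof. by move=> cF; apply: cvg_big => //; exact: mul_continuous. Qed.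

Lemma Pns_compact (R : realType) (n s : nat) : compact (Pns R n s).
Proof.
have cbox := @rV_compact R n (fun=> `[0, 1]%classic)
  (fun=> @segment_compact _ _ _).
apply: subclosed_compact cbox _; last first.
  by move=> x [_ x01] i; rewrite /= in_itv; exact: x01.
have -> : Pns R n s =
    [set x : 'rV[R]_n | \sum_(i < n) x 0 i \in [set s%:R]] `&`
    \bigcap_(i in [set: 'I_n]) [set x : 'rV[R]_n | x 0 i \in `[0, 1]%classic].
  apply/seteqP; split=> x [xs x01]; split.
  - exact/mem_set.
  - by move=> i _; apply/mem_set; rewrite /= in_itv; exact: x01.
  - by move/set_mem: xs.
  - by move=> i; have /set_mem := x01 i I; rewrite /= in_itv.
have clo (f : 'rV[R]_n -> R) (A : set R) :
    continuous f -> closed A -> closed [set x | f x \in A].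
  move=> cf cA; rewrite (_ : [set x | _] = f @^-1` A); last first.
    by apply/seteqP; split=> x /=; rewrite inE.
  by apply: preimage_closed => // x _; exact: cf.
apply: closedI; first apply: clo.
- move=> x.
  apply: (@cvg_bsum _ _ _ (fun i (y : 'rV[R]_n) => y 0 i)) => i.
  exact: coord_continuous.
- exact: closed_eq.
- apply: closed_bigI => i _; apply: clo; first exact: coord_continuous.
  exact: itv_closed.
Qed.

Lemma Pns_nonempty (R : realType) (n s : nat) :
  (0 < s < n)%N -> Pns R n s !=set0.
Proof.
move=> /andP[s0 sn]; have n0 : (0 < n)%N by exact: ltn_trans sn.
exists (const_mx (s%:R / n%:R)); split=> [|i].
  under eq_bigr do rewrite mxE.
  by rewrite sumr_const card_ord -[LHS]mulr_natr divfK // pnatr_eq0 -lt0n.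
by rewrite mxE divr_ge0 ?ler0n //= ler_pdivrMr ?ltr0n // mul1r ler_nat ltnW.
Qed.

Lemma linx_det_continuous (R : realType) (n : nat) (C : 'M[R]_n) (gamma : R)
    (T : topologicalType) (f : T -> 'rV[R]_n) (t : T) :
    (forall i, f y 0 i @[y --> t] --> f t 0 i) ->
  \det (linx_mx C gamma (f y)) @[y --> t] --> \det (linx_mx C gamma (f t)).
Proof.
move=> cf.
have linxE (x : 'rV[R]_n) i j : linx_mx C gamma x i j =
    gamma * (\sum_k C i k * x 0 k * C k j) + (1 - x 0 i) * (i == j)%:R.
  rewrite !mxE mulr_natr; congr (_ * _ + _).
  by apply: eq_bigr => k _; rewrite mul_mx_diag mxE.
have linx_cvg i j :
    linx_mx C gamma (f y) i j @[y --> t] --> linx_mx C gamma (f t) i j.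
  rewrite linxE; under eq_cvg do rewrite linxE.
  apply: (@cvgD _ R^o).
    apply: cvgM; first exact: cvg_cst.
    apply: (@cvg_bsum _ _ _ (fun k y => C i k * f y 0 k * C k j)) => k.
    apply: cvgM; last exact: cvg_cst.
    by apply: cvgM; [exact: cvg_cst | exact: cf].
  apply: cvgM; last exact: cvg_cst.
  by apply: (@cvgB _ R^o); [exact: cvg_cst | exact: cf].
apply: (@cvg_bsum _ _ _ (fun (p : {perm 'I_n}) y =>
  (-1) ^+ p * \prod_i linx_mx C gamma (f y) i (p i))) => p.
apply: cvgM; first exact: cvg_cst.
exact: (@cvg_bprod _ _ _ (fun i y => linx_mx C gamma (f y) i (p i))).
Qed.

Lemma linx_max (R : realType) (n s : nat) (C : 'M[R]_n) (gamma : R) :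
  (0 < s < n)%N ->
  exists2 x, Pns R n s x & linx C s gamma = linx_obj C s gamma x.
Proof.
move=> sn.
have cdet : {within Pns R n s, continuous (fun x => \det (linx_mx C gamma x))}.
  apply: continuous_subspaceT => x.
  by apply: (@linx_det_continuous _ _ _ _ _ id) => i; exact: coord_continuous.
have [x /set_mem Px xmax] :=
  EVT_max_rV (@Pns_nonempty R n s sn) (@Pns_compact R n s) cdet.
exists x => //; apply/eqP; rewrite eq_le; apply/andP; split.
  apply: ge_ereal_sup => _ [y Py <-].
  apply: lee_wpmul2l; first by rewrite lee_fin invr_ge0.
  by apply: leeB => //; apply: le_lne; exact/xmax/mem_set.
by apply: ereal_sup_ubound; exists x.
Qed.

(* Main.v *)
Require Import Defs.
From mathcomp Require Import all_boot all_order all_fingroup all_algebra.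
From mathcomp Require Import all_classical all_reals all_analysis.
From mathcomp Require Import lra.
Import Order.TTheory GRing.Theory Num.Theory.
Import numFieldNormedType.Exports.

Local Open Scope classical_set_scope.
Local Open Scope ring_scope.

(** Let r be the rank of C. The matrix gamma C Diag(x) C has rank at most r, so
    det (gamma C Diag(x) C + Diag(e - x)) is a polynomial in gamma of degree at
    most r, with coefficients that are bounded uniformly over 0 <= x <= e. The
    objective subtracts s log gamma with s >= r + 1, so for gamma >= 1
    linx(C, s; gamma) <= (const - log gamma) / 2, which tends to -oo
    ([linx_mx_det_le], [linx_le]).

    This limit forces the infimum over gamma > 0 to be -oo, whereas each single
    value linx(C, s; gamma) is larger than -oo: at the barycentre x = (s/n) e
    of P(n, s), where s/n < 1, the matrix gamma (s/n) C^2 + (1 - s/n) I is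
    positive definite and so has positive determinant ([linx_mx_det_gt0],
    [linx_gtNy]). Hence the infimum is not attained.

    The degree bound is obtained without expanding the determinant in gamma: a
    rank factorisation C = L M turns it into a determinant of order r + n, out
    of whose first r columns gamma can be pulled ([det_addmx_scale]); the
    entries that remain are bounded for gamma >= 1. *)

(** By a Schur complement, the left-hand side is the determinant of the block
    matrix with rows (1, - M) and (g L, E); its first r columns are g times
    those of the block matrix on the right. The exponent is the inner dimension
    r, whatever n is: this is where the rank of C bounds the growth in gamma. *)
Lemma det_addmx_scale (F : fieldType) (n r : nat) (E : 'M[F]_n)
    (L : 'M[F]_(n, r)) (M : 'M[F]_(r, n)) (g : F) : g != 0 ->
  \det (g *: (L *m M) + E) = g ^+ r * \det (block_mx g^-1%:M (- M) L E).
Proof.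
move=> g0.
(* Multiplying on the right by this upper triangular matrix both rescales the
   first r columns by g and clears the upper right block. *)
have detU : \det (block_mx g%:M (g *: M) 0 (1%:M : 'M[F]_n)) = g ^+ r.
  by rewrite det_ublock det_scalar det1 mulr1.
rewrite mulrC -detU -det_mulmx mulmx_block.
rewrite !(mulmx0, addr0, mulmx1) mul_scalar_mx scale_scalar_mx mulVf //.
rewrite mul_scalar_mx scalerA mulVf // scale1r subrr det_lblock det1 mul1r.
by rewrite -scalemxAr.
Qed.

(** Each of the n! terms of the Leibniz formula is a product of n entries. *)
Lemma det_norm_le (R : numDomainType) (n : nat) (A : 'M[R]_n) (b : R) :
  (forall i j, `|A i j| <= b) -> `|\det A| <= n`!%:R * b ^+ n.
Proof.
move=> Ab; apply: le_trans (ler_norm_sum _ _ _) _.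
have -> : n`!%:R * b ^+ n = \sum_(p : {perm 'I_n}) b ^+ n.
  by rewrite sumr_const card_Sn mulr_natl.
apply: ler_sum => p _; rewrite normrMsign normr_prod.
rewrite -[in b ^+ n](card_ord n) -prodr_const.
by apply: ler_prod => i _; rewrite normr_ge0 Ab.
Qed.

Lemma mx_entry_le_norm (R : realDomainType) (m n : nat) (A : 'M[R]_(m, n)) i j :
  `|A i j| <= `|A|.
Proof.
rewrite [leRHS]/Num.norm /= mx_normrE.
exact: (le_bigmax _ (fun ij : 'I_m * 'I_n => `|A ij.1 ij.2|) (i, j)).
Qed.

(** The determinant grows at most like gamma ^ rank C, uniformly in x; the
    restriction gamma >= 1 keeps the entries gamma^-1 of the block matrix of
    [det_addmx_scale] bounded. *)
Lemma linx_mx_det_le (R : realType) (n : nat) (C : 'M[R]_n) :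
  exists2 K : R, 0 < K & forall gamma (x : 'rV[R]_n), 1 <= gamma ->
    (forall i, 0 <= x 0 i <= 1) ->
    \det (linx_mx C gamma x) <= K * gamma ^+ \rank C.
Proof.
pose r := \rank C.
have [L [M LM]] : exists (L : 'M[R]_(n, r)) (M : 'M[R]_(r, n)), L *m M = C.
  by exists (col_base C), (row_base C); exact: mulmx_base.
pose a := `|L|.
pose c := n%:R * (`|M| * `|C|).
have a0 : 0 <= a by exact: normr_ge0.
have c0 : 0 <= c by rewrite !mulr_ge0.
(* 1 bounds the two diagonal blocks, a the block L, and c the block
   - M Diag(x) C. *)
pose b := 1 + a + c.
have b0 : 0 < b by rewrite /b; lra.
exists ((r + n)`!%:R * b ^+ (r + n)) => [|g x g1 x01].
  by rewrite mulr_gt0 ?exprn_gt0 // ltr0n fact_gt0.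
have g0 : 0 < g by apply: lt_le_trans g1.
pose E := diag_mx (const_mx 1 - x).
have -> : \det (linx_mx C g x) =
    g ^+ r * \det (block_mx g^-1%:M (- (M *m diag_mx x *m C)) L E).
  rewrite -(@det_addmx_scale R) ?gt_eqF //.
  by rewrite /linx_mx !mulmxA LM.
rewrite mulrC ler_wpM2r ?exprn_ge0 ?(ltW g0) //.
apply: le_trans (ler_norm _) _; apply: det_norm_le => i j.
have le_b0 : 0 <= b := ltW b0.
have le_b1 : 1 <= b by rewrite /b; lra.
have diag_le m (y : R) (k l : 'I_m) : 0 <= y <= 1 -> `|y *+ (k == l)| <= b.
  by case: (k == l); rewrite ?mulr0n ?normr0 // mulr1n => y01;
    rewrite ger0_norm; lra.
case: (split_ordP i) => k ->; case: (split_ordP j) => l ->.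
- rewrite block_mxEul mxE; apply: diag_le.
  by rewrite invr_ge0 (ltW g0) invf_le1.
- rewrite block_mxEur mxE normrN.
  have : `|(M *m diag_mx x *m C) k l| <= c.
    rewrite mxE; apply: le_trans (ler_norm_sum _ _ _) _.
    have -> : c = \sum_(m < n) `|M| * `|C|.
      by rewrite sumr_const card_ord -mulr_natl.
    apply: ler_sum => m _; rewrite mul_mx_diag mxE normrM.
    apply: ler_pM => //; last exact: mx_entry_le_norm.
    have /andP[x0 x1] := x01 m; rewrite normrM (ger0_norm x0).
    by apply: le_trans (mx_entry_le_norm R _ _ M k m); rewrite ler_piMr.
  by rewrite /b; lra.
- rewrite block_mxEdl.
  have : `|L k l| <= a by exact: mx_entry_le_norm.
  by rewrite /b; lra.
- rewrite block_mxEdr !mxE; apply: diag_le.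
  by have := x01 k; lra.
Qed.

Lemma dot_row_ge0_gt0 (R : realDomainType) (n : nat) (v : 'rV[R]_n) :
  0 <= (v *m v^T) 0 0 /\ (v != 0 -> 0 < (v *m v^T) 0 0).
Proof.
have E : (v *m v^T) 0 0 = \sum_i v 0 i ^+ 2.
  by rewrite mxE; apply: eq_bigr => i _; rewrite mxE.
have ge0 : 0 <= (v *m v^T) 0 0.
  by rewrite E sumr_ge0 // => i _; rewrite sqr_ge0.
split=> // v0; rewrite lt_neqAle ge0 andbT eq_sym; apply: contraNneq v0.
rewrite E => /eqP; rewrite psumr_eq0 => [/allP z|i _]; last exact: sqr_ge0.
apply/eqP/rowP => i; rewrite mxE.
by have /(_ (mem_index_enum _)) := z i; rewrite sqrf_eq0 => /eqP.
Qed.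

(** With x = t e the matrix is gamma t C^2 + (1 - t) I. If it kills the row v,
    then gamma t |v C|^2 + (1 - t) |v|^2 = 0, and so v = 0. *)
Lemma linx_mx_det_neq0 (R : realType) (n : nat) (C : 'M[R]_n) (gamma t : R) :
  C^T = C -> 0 <= gamma -> 0 <= t < 1 ->
  \det (linx_mx C gamma (const_mx t)) != 0.
Proof.
move=> Csym g0 /andP[t0 t1]; apply/negP => /det0P[v v0 vA].
have : 0 < gamma * t * (v *m C *m (v *m C)^T) 0 0 + (1 - t) * (v *m v^T) 0 0.
  have [_ /(_ v0) vv] := dot_row_ge0_gt0 _ _ v.
  have [vC _] := dot_row_ge0_gt0 _ _ (v *m C).
  by rewrite ltr_wpDl ?mulr_ge0 // mulr_gt0 // subr_gt0.
suff -> : gamma * t * (v *m C *m (v *m C)^T) 0 0 + (1 - t) * (v *m v^T) 0 0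
    = (v *m linx_mx C gamma (const_mx t) *m v^T) 0 0.
  by rewrite vA mul0mx mxE ltxx.
have -> : linx_mx C gamma (const_mx t) =
    (gamma * t) *: (C *m C) + (1 - t) *: 1%:M.
  rewrite /linx_mx diag_const_mx mul_mx_scalar -scalemxAl scalerA.
  congr (_ + _); rewrite scale_scalar_mx mulr1 -diag_const_mx.
  by congr diag_mx; apply/rowP => i; rewrite !mxE.
rewrite mulmxDr -!scalemxAr mulmx1 mulmxDl -!scalemxAl trmx_mul Csym.
by rewrite !mulmxA !mxE.
Qed.

(** The determinant is 1 at t = 0 and does not vanish on [0, 1), so by the
    intermediate value theorem it stays positive. *)
Lemma linx_mx_det_gt0 (R : realType) (n : nat) (C : 'M[R]_n) (gamma t : R) :
  C^T = C -> 0 <= gamma -> 0 <= t < 1 ->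
  0 < \det (linx_mx C gamma (const_mx t)).
Proof.
move=> Csym g0 /andP[t0 t1].
pose f (u : R) := \det (linx_mx C gamma (const_mx u)).
have cf : continuous f.
  move=> u; apply: (@linx_det_continuous R n C gamma R (fun u => const_mx u)).
  move=> i; rewrite mxE; under eq_cvg do rewrite mxE.
  exact: cvg_id.
have f0 : f 0 = 1.
  rewrite /f /linx_mx diag_const_mx raddf0 mulmx0 mul0mx scaler0 add0r.
  have -> : const_mx 1 - const_mx 0 = const_mx 1 :> 'rV[R]_n.
    by apply/rowP => i; rewrite !mxE subr0.
  by rewrite diag_const_mx det1.
rewrite ltNge; apply/negP => ft; rewrite -/(f t) in ft.
have [||u /[!in_itv]/= /andP[u0 ut] /eqP] := @IVT R f 0 t 0 t0.
- exact: continuous_subspaceT.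
- by rewrite f0 ge_min le_max ft ler01 orbT.
by apply/negP/linx_mx_det_neq0 => //; rewrite u0 (le_lt_trans ut).
Qed.

(** The barycentre (s/n) e is a feasible point with a finite objective. *)
Lemma linx_gtNy (R : realType) (n s : nat) (C : 'M[R]_n) (gamma : R) :
  C^T = C -> (0 < s < n)%N -> 0 < gamma -> (-oo < linx C s gamma)%E.
Proof.
move=> Csym /andP[s0 sn] g0.
have n0 : (0 < n)%N by exact: ltn_trans sn.
have n0R : 0 < n%:R :> R by rewrite ltr0n.
pose t : R := s%:R / n%:R.
have t01 : 0 <= t < 1.
  by rewrite divr_ge0 ?ler0n //= ltr_pdivrMr // mul1r ltr_nat.
have Pt : Pns R n s (const_mx t).
  split=> [|i]; last by rewrite mxE; lra.
  under eq_bigr do rewrite mxE.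
  by rewrite sumr_const card_ord -[LHS]mulr_natr divfK // gt_eqF.
have : (linx_obj C s gamma (const_mx t) <= linx C s gamma)%E.
  by apply: ereal_sup_ubound; exists (const_mx t).
apply: lt_le_trans.
rewrite /linx_obj /ldet lne_EFin; last exact: linx_mx_det_gt0 (ltW g0) t01.
by rewrite -EFinB -EFinM ltNyr.
Qed.

(** As s exceeds the rank by at least 1, the terms
    rank C * ln gamma - s * ln gamma add up to at most - ln gamma. *)
Lemma linx_le (R : realType) (n s : nat) (C : 'M[R]_n) :
  (\rank C < s)%N ->
  exists K : R, forall gamma, 1 <= gamma ->
    (linx C s gamma <= (2^-1 * (K - ln gamma))%:E)%E.
Proof.
move=> rs; have [K K0 detK] := @linx_mx_det_le R n C.
exists (ln K) => g g1; have g0 : 0 < g by apply: lt_le_trans g1.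
apply: ge_ereal_sup => _ [x [_ x01] <-].
rewrite EFinM; apply: lee_wpmul2l; first by rewrite lee_fin invr_ge0.
rewrite leeBlDr // -EFinD.
have Kg0 : 0 < K * g ^+ \rank C by rewrite mulr_gt0 ?exprn_gt0.
apply: le_trans (le_lne (detK _ _ g1 x01)) _.
rewrite lne_EFin // lee_fin lnM ?posrE ?exprn_gt0 // lnXn //.
rewrite -addrA lerD2l -mulr_natr.
have lg : 0 <= ln g by rewrite ln_ge0.
have rs' : (\rank C)%:R + 1 <= s%:R :> R by rewrite natr1 ler_nat.
nra.
Qed.

Theorem theorem3p9 (R : realType) (n s : nat) (C : 'M[R]_n)
    (hC : psdmx C) (hs : (0 < s < n)%N) (hrank : (\rank C < s)%N) :
  (linx C s gamma @[gamma --> +oo] --> -oo%E) /\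
  ~ (exists2 gamma_hat : R, 0 < gamma_hat &
       linx C s gamma_hat =
       ereal_inf [set linx C s gamma | gamma in [set gamma : R | 0 < gamma]]).
Proof.
have lim : linx C s gamma @[gamma --> +oo] --> -oo%E.
  have [K leK] := @linx_le R n s C hrank.
  apply/cvgeNyPle => A; near=> g.
  apply: le_trans (leK g _) _; first by near: g; exact: nbhs_pinfty_ge.
  rewrite lee_fin.
  suff : K - 2 * A <= ln g by lra.
  have expg : expR (K - 2 * A) <= g by near: g; exact: nbhs_pinfty_ge.
  by rewrite -[leLHS]expRK ler_ln // posrE ?expR_gt0.
split=> // -[gh gh0 linxE].
have : (-oo < linx C s gh)%E by apply: linx_gtNy => //; case: hC.
rewrite linxE ltNge => /negP; apply.
(* The infimum is a lower bound of linx near +oo, hence of its limit. *)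
apply: cvge_ge lim; near=> g.
by apply: ereal_inf_lbound; exists g => /=.
Unshelve. all: by end_near.
Qed.
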